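(* Let $A \in M_{2n\times 2n}(\mathbb{C})$ be diagonalizable. (1) Assume that $A$ is skew-Hamiltonian. Then $A$ is symplectic diagonalizable if and only if for any real eigenvalue $\lambda \in \sigma(A)$ and some basis $v_1,\dots,v_m$ of the corresponding eigenspace, the matrix $V^H J_{2n} V$ with $V = [\,v_1\;\cdots\;v_m\,]$ has equally many positive and negative imaginary eigenvalues. (2) Assume that $A$ is Hamiltonian. Then $A$ is symplectic diagonalizable if and only if for any purely imaginary eigenvalue $\lambda \in \sigma(A)$ and some basis $v_1,\dots,v_m$ of the corresponding eigenspace, the matrix $V^H J_{2n} V$ with $V = [\,v_1\;\cdots\;v_m\,]$ has equally many positive and negative imaginary eigenvalues.
   Context: $M_{m\times m}(\mathbb{C})$ is the space of complex $m\times m$ matrices, $A^H=\overline{A}^T$ is the Hermitian transpose, and $\sigma(A)$ is the set of eigenvalues of $A$. $J_{2n} = \begin{bmatrix} 0 & I_n \\ -I_n & 0\end{bmatrix}$. A matrix $A \in M_{2n\times 2n}(\mathbb{C})$ is skew-Hamiltonian if $J_{2n}^T A^H J_{2n} = A$, and Hamiltonian if $J_{2n}^T A^H J_{2n} = -A$. A matrix $S \in M_{2n\times 2n}(\mathbb{C})$ is symplectic if it is invertible with $J_{2n}^T S^H J_{2n} = S^{-1}$ (equivalently $S^H J_{2n} S = J_{2n}$). $A$ is symplectic diagonalizable if there is a symplectic $S$ such that $S^{-1}AS$ is diagonal. The number $0$ is regarded as both real and purely imaginary when it occurs as an eigenvalue $\lambda$ of $A$. The matrix $V^H J_{2n}V$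 is skew-Hermitian, so its eigenvalues lie in $i\mathbb{R}$; a positive (negative) imaginary eigenvalue is one of the form $i t$ with $t>0$ ($t<0$), and eigenvalues are counted with multiplicity. *)

(* Defs.v *)
From mathcomp Require Export all_boot all_order all_algebra.
From mathcomp Require Export complex reals.

Set Implicit Arguments.
Unset Strict Implicit.
Unset Printing Implicit Defensive.

Import Order.TTheory GRing.Theory Num.Theory.
Local Open Scope ring_scope.
Local Open Scope sesquilinear_scope.

Section Structured.
Variables (C : numClosedFieldType) (n : nat).
Implicit Types A S : 'M[C]_(n + n).

Definition J2n : 'M[C]_(n + n) := block_mx 0 1%:M (- 1%:M) 0.

Definition skew_hamiltonian A : Prop := J2n^T *m A ^t* *m J2n = A.

Definition hamiltonian A : Prop := J2n^T *m A ^t* *m J2n = - A.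

Definition symplectic S : Prop :=
  S \in unitmx /\ J2n^T *m S ^t* *m J2n = invmx S.

Definition symplectic_diagonalizable A : Prop :=
  exists S, symplectic S /\ is_diag_mx (invmx S *m A *m S).

End Structured.

Section Spectrum.
Variable C : numClosedFieldType.

(* [eigenspace] is spanned by row vectors v with v *m g = a *: v; transposing
   turns it into the space of column vectors v with A *m v = a *: v.
   [row_free V^T] says that the columns of V are linearly independent. *)
Definition eigenspace_basis p m (A : 'M[C]_p) (a : C) (V : 'M[C]_(p, m)) : Prop :=
  row_free V^T /\ (V^T == eigenspace A^T a)%MS.

(* The roots of the (monic) characteristic polynomial, each repeated according
   to its multiplicity. *)
Definition eigenvalues m (M : 'M[C]_m) : seq C :=
  sval (closed_field_poly_normal (char_poly M)).

Definition pos_imaginary : pred C := fun z => ('Re z == 0) && (0 < 'Im z).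

Definition neg_imaginary : pred C := fun z => ('Re z == 0) && ('Im z < 0).

Definition balanced m (M : 'M[C]_m) : Prop :=
  count pos_imaginary (eigenvalues M) = count neg_imaginary (eigenvalues M).

End Spectrum.

(* Main.v *)
(* Write J = J2n. For a Hamiltonian A the matrix i A is skew-Hamiltonian with
   the same eigenvectors, so only the skew-Hamiltonian case matters: there A is
   self-adjoint for the form x^H J y, and the eigenspaces of a and b are
   orthogonal unless a is the conjugate of b.

   If S is symplectic and S^-1 A S is diagonal, the columns of S belonging to a
   form a basis V of the eigenspace such that V^H J V is a principal submatrix
   of J. Conjugation by a diagonal sign matrix turns it into its opposite, so
   its spectrum is symmetric.

   Conversely, every eigenspace E_a is a sum of two isotropic subspaces X_a and
   Z_a: for a real, diagonalize V^H J V unitarily and normalize; pairing each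
   positive vector p with a negative one q gives isotropic vectors p + q and
   p - q. For 'Im a > 0 take X_a = E_a and Z_a = 0, and for 'Im a < 0 the
   opposite. The sums L of the X_a and M of the Z_a are then isotropic, hence of
   dimension at most n, and together they span, so both are Lagrangian. If X is
   an eigenvector basis of L, the J-dual basis of X in the A-stable space M
   consists of eigenvectors too, and both bases together form the columns of S. *)

Require Import Defs.
From mathcomp Require Import ring zify.
Import Order.TTheory GRing.Theory Num.Theory.
Local Open Scope ring_scope.
Local Open Scope sesquilinear_scope.

Set Implicit Arguments.
Unset Strict Implicit.
Unset Printing Implicit Defensive.

(** * Spectra of skew-Hermitian matrices *)

Lemma trmxC_mul (C : numClosedFieldType) m n p (A : 'M[C]_(m, n)) (B : 'M[C]_(n, p)) :
  (A *m B) ^t* = B ^t* *m A ^t*.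
Proof. by rewrite trmx_mul map_mxM. Qed.

Lemma char_poly_similar (F : fieldType) n (P A B : 'M[F]_n) :
  P \in unitmx -> P *m A = B *m P -> char_poly A = char_poly B.
Proof.
move=> Pu PA; rewrite /char_poly.
have P0 : \det (map_mx polyC P) != 0 by rewrite det_map_mx polyC_eq0 -unitfE.
apply: (mulfI P0); rewrite [RHS]mulrC -!det_mulmx; congr (\det _).
by rewrite mulmxBr mulmxBl -!map_mxM PA scalar_mxC.
Qed.

(** [eigenvalues] picks some listing of the roots, so unique factorization determines it only up to
    order. *)
Lemma perm_eigenvalues (C : numClosedFieldType) m (M : 'M[C]_m) (s : seq C) :
  char_poly M = \prod_(z <- s) ('X - z%:P) -> perm_eq (eigenvalues M) s.
Proof.
move=> cM; apply: prod_XsubC_eq; rewrite -cM /eigenvalues.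
case: closed_field_poly_normal => r /= {1}->.
by rewrite (monicP (char_poly_monic M)) scale1r.
Qed.

(** A skew-Hermitian matrix is normal, so the spectral theorem applies; the resulting diagonal
    matrix is again skew-Hermitian, which makes its entries purely imaginary. *)
Lemma skew_spectral (C : numClosedFieldType) m (K : 'M[C]_m) :
  K ^t* = - K ->
  exists U : 'M[C]_m, exists d : 'rV[C]_m,
    [/\ U \is unitarymx, U *m K *m U ^t* = diag_mx d,
        forall i, 'Re (d 0 i) = 0 &
        perm_eq (eigenvalues K) [seq d 0 i | i : 'I_m]].
Proof.
move=> skK; have nK : K \is normalmx by apply/normalmxP; rewrite skK mulmxN mulNmx.
have /orthomx_spectralP := nK.
move: (spectral_unitarymx K) (spectral_diag K).
move: (spectralmx K) => U Uu d; have Uu' := unitarymx_unit Uu => eK.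
have UK : U *m K = diag_mx d *m U by rewrite eK !mulmxA mulmxV // mul1mx.
have UKU : U *m K *m U ^t* = diag_mx d.
  by rewrite UK -mulmxA (unitarymxP Uu) mulmx1.
exists U, d; split=> //.
  move=> i; have /(congr1 (fun M => M ^t*)) := UKU.
  rewrite !trmxC_mul trmxCK mulmxA skK mulmxN mulNmx UKU => /matrixP/(_ i i).
  rewrite !mxE eqxx !mulr1n => di; rewrite ReE -di subrr ?mul0r ?mulr0 //.
apply: perm_eigenvalues; rewrite (char_poly_similar Uu' UK).
rewrite char_poly_trig ?diag_mx_is_trig // big_map enumT.
by apply: eq_bigr => i _; rewrite mxE eqxx.
Qed.

(** Turns a count of roots into a comparison of two index sets, which can then be matched element by
    element. *)
Lemma skew_balanced (C : numClosedFieldType) m (K : 'M[C]_m) (d : 'rV[C]_m) :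
  (forall i, 'Re (d 0 i) = 0) -> perm_eq (eigenvalues K) [seq d 0 i | i : 'I_m] ->
  balanced K <-> #|[set i | 0 < 'Im (d 0 i)]| = #|[set i | 'Im (d 0 i) < 0]|.
Proof.
move=> Red Kd; rewrite /balanced !(permP Kd) !count_map !cardE /enum_mem -!enumT.
rewrite !size_filter.
suff -> : count (preim (d 0) (@pos_imaginary C)) (enum 'I_m)
  = count (mem [set i | 0 < 'Im (d 0 i)]) (enum 'I_m).
  suff -> : count (preim (d 0) (@neg_imaginary C)) (enum 'I_m)
    = count (mem [set i | 'Im (d 0 i) < 0]) (enum 'I_m) by [].
  by apply: eq_count => i; rewrite /= inE /neg_imaginary Red eqxx.
by apply: eq_count => i; rewrite /= inE /pos_imaginary Red eqxx.
Qed.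

(** Similarity of [K] and [- K] makes the multiset of eigenvalues stable under negation, which
    exchanges the two half-axes. *)
Lemma balanced_opp (C : numClosedFieldType) m (T K : 'M[C]_m) :
  K ^t* = - K -> T \in unitmx -> T *m K = - K *m T -> balanced K.
Proof.
move=> skK Tu TK; have [U [d [Uu UKU Red Kd]]] := skew_spectral skK.
apply/(skew_balanced Red Kd).
have Kd' : perm_eq (eigenvalues K) [seq (- d) 0 i | i : 'I_m].
  apply: perm_eigenvalues; rewrite (char_poly_similar Tu TK).
  have UK : U *m - K = diag_mx (- d) *m U.
    rewrite mulmxN linearN /= mulNmx -UKU -(invmx_unitary Uu).
    by rewrite mulmxKV ?unitarymx_unit.
  rewrite (char_poly_similar (unitarymx_unit Uu) UK).
  rewrite char_poly_trig ?diag_mx_is_trig // big_map enumT.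
  by apply: eq_bigr => i _; rewrite mxE eqxx.
have {Kd}Kd : perm_eq [seq d 0 i | i : 'I_m] [seq (- d) 0 i | i : 'I_m].
  by rewrite -(permPl Kd).
rewrite !cardE /enum_mem -!enumT !size_filter.
have := permP Kd (fun z => 0 < 'Im z); rewrite !count_map.
rewrite (@eq_count _ _ (mem [set i | 0 < 'Im (d 0 i)])); last by move=> i; rewrite /= inE.
move=> ->; apply: eq_count => i; rewrite /= inE mxE.
by rewrite raddfN /= oppr_gt0.
Qed.

(** * Isotropic splitting of a balanced skew-Hermitian form *)

(** The k-th element of [enum P] is exchanged with the k-th element of [enum N]. *)
Lemma swap_involution (T : finType) (P N : {set T}) :
  [disjoint P & N] -> #|P| = #|N| ->
  exists s : T -> T, [/\ involutive s, {in P, forall i, s i \in N},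
    {in N, forall i, s i \in P} & forall i, i \notin P -> i \notin N -> s i = i].
Proof.
move=> PN eqPN.
pose s i := if i \in P then nth i (enum N) (index i (enum P)) else
            if i \in N then nth i (enum P) (index i (enum N)) else i.
have sP i : i \in P -> s i \in N.
  move=> iP; suff: s i \in enum N by rewrite mem_enum.
  by rewrite /s iP mem_nth // -cardE -eqPN cardE index_mem mem_enum.
have sN i : i \in N -> s i \in P.
  move=> iN; suff: s i \in enum P by rewrite mem_enum.
  rewrite /s iN (disjointFl PN) // mem_nth // -cardE eqPN cardE.
  by rewrite index_mem mem_enum.
exists s; split=> //; last by move=> i /negPf iP /negPf iN; rewrite /s iP iN.
move=> i; have [iP | iNP] := boolP (i \in P).
  rewrite [LHS]/s sP // (disjointFl PN (sP _ iP)) /s iP index_uniq ?enum_uniq //.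
    by rewrite (set_nth_default i) ?nth_index ?mem_enum // index_mem mem_enum.
  by rewrite -cardE -eqPN cardE index_mem mem_enum.
have [iN | iNN] := boolP (i \in N).
  rewrite [LHS]/s sN // /s iN (negPf iNP) index_uniq ?enum_uniq //.
    by rewrite (set_nth_default i) ?nth_index ?mem_enum // index_mem mem_enum.
  by rewrite -cardE eqPN cardE index_mem mem_enum.
by rewrite /s (negPf iNP) (negPf iNN) (negPf iNP) (negPf iNN).
Qed.

Lemma balanced_isotropic (C : numClosedFieldType) m (K : 'M[C]_m) :
  K ^t* = - K -> balanced K ->
  exists X : 'M[C]_m, exists Z : 'M[C]_m,
    [/\ X *m K *m X ^t* = 0, Z *m K *m Z ^t* = 0 & (1%:M <= X + Z)%MS].
Proof.
move=> skK; have [U [d [Uu UKU Red Kd]]] := skew_spectral skK.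
move/(skew_balanced Red Kd) => cardPN.
set P := [set i | _] in cardPN; set N := [set i | _] in cardPN.
have dPN : [disjoint P & N].
  by rewrite disjoints_subset; apply/subsetP => i; rewrite !inE => /lt_gtF ->.
have [s [ss sP sN s0]] := swap_involution dPN cardPN.
(* Scaling row i of [U] by |d_i|^(-1/2) turns d_i into ['i], [- 'i] or 0 according to the sign of
   its imaginary part; rows with d_i = 0 stay as they are. *)
pose c := \row_i if d 0 i == 0 then 1 else (sqrtC `|d 0 i|)^-1 : C.
have c0 i : c 0 i != 0.
  by rewrite mxE; case: ifP; rewrite ?oner_eq0 // => di; rewrite invr_eq0 sqrtC_eq0 normr_eq0 di.
pose e i := c 0 i * d 0 i * (c 0 i)^*.
have dI i : d 0 i = 'i * 'Im (d 0 i) by rewrite {1}[d 0 i]Crect Red add0r.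
have eE i : e i = 'i * Num.sg ('Im (d 0 i)).
  rewrite /e mxE; have [d0|dn0] := eqVneq (d 0 i) 0.
    by rewrite d0 mulr0 mul0r raddf0 sgr0 mulr0.
  have /CrealP -> : (sqrtC `|d 0 i|)^-1 \is Num.real.
    by rewrite rpredV ger0_real // sqrtC_ge0.
  rewrite mulrAC -invfM -expr2 sqrtCK mulrC {1}dI -mulrA; congr (_ * _).
  have -> : `|d 0 i| = `|'Im (d 0 i)| by rewrite {1}dI normrM normCi mul1r.
  rewrite {1}[X in X / _]realEsg ?Creal_Im // mulfK // normr_eq0.
  by apply: contraNneq dn0 => I0; rewrite dI I0 mulr0.
have se i : e (s i) = - e i.
  rewrite !eE -mulrN; congr (_ * _).
  have [iP|iNP] := boolP (i \in P).
    have := sP _ iP; move: iP; rewrite !inE => dp dn.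
    by rewrite (gtr0_sg dp) (ltr0_sg dn).
  have [iN|iNN] := boolP (i \in N).
    have := sN _ iN; move: iN; rewrite !inE => dn dp.
    by rewrite (gtr0_sg dp) (ltr0_sg dn) opprK.
  rewrite s0 //; move: iNP iNN; rewrite !inE.
  by case: (real_ltgtP (real0 C) (Creal_Im (d 0 i))) => // <-; rewrite sgr0 oppr0.
pose F := diag_mx c *m U; pose G := rowsub s F.
have FF : F *m K *m F ^t* = diag_mx (\row_i e i).
  rewrite trmxC_mul mulmxA -(mulmxA _ U) -(mulmxA _ _ (U ^t*)) UKU.
  rewrite tr_diag_mx map_diag_mx !mulmx_diag; congr diag_mx.
  by apply/rowP => i; rewrite !mxE /e !mxE.
have form f g : rowsub f F *m K *m (rowsub g F) ^t* =
    \matrix_(i, j) (e (f i) *+ (f i == g j)).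
  rewrite trmx_mxsub map_mxsub mul_rowsub_mx -mxsub_mul FF.
  by apply/matrixP => i j; rewrite !mxE.
have FE : F = rowsub id F by apply/matrixP => i j; rewrite !mxE.
have s_eq i j : (i == s j) = (s i == j) by rewrite -(inj_eq (can_inj ss)) ss.
(* Entry (i, j) of the Gram matrix of [F + G] is e_i ([i = j] + [i = s j]) + e_(s i) ([s i = j] +
   [s i = s j]). It vanishes since e_(s i) = - e_i and [s] is an involution; [F - G] is similar. *)
exists (F + G), (F - G); split.
- rewrite linearD /= map_mxD !(mulmxDl, mulmxDr) [X in X *m K]FE [X in X ^t*]FE.
  rewrite !form; apply/matrixP => i j; rewrite !mxE /= !se.
  rewrite (inj_eq (can_inj ss)) s_eq.
  by rewrite !mulNrn; ring.
- rewrite linearB /= map_mxB !(mulmxBl, mulmxBr) [X in X *m K]FE [X in X ^t*]FE.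
  rewrite !form; apply/matrixP => i j; rewrite !mxE /= !se.
  rewrite (inj_eq (can_inj ss)) s_eq !mulNrn opprK.
  by ring.
have Fu : F \in unitmx.
  rewrite unitmx_mul (unitarymx_unit Uu) andbT unitmxE det_diag unitfE.
  by apply/prodf_neq0 => i _.
(* [F] is half the sum of the two matrices and is invertible, so their rows span everything. *)
have -> : 1%:M = invmx F *m (2^-1 *: ((F + G) + (F - G))).
  rewrite addrACA subrr addr0 -mulr2n -scaler_nat scalerA mulVf ?pnatr_eq0 //.
  by rewrite scale1r mulVmx.
by rewrite mulmx_sub // scalemx_sub // addmx_sub_adds.
Qed.

Lemma char_poly_tr (R : comNzRingType) n (A : 'M[R]_n) : char_poly A^T = char_poly A.
Proof.
rewrite /char_poly -[RHS]det_tr; congr (\det _).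
by rewrite /char_poly_mx [RHS]linearB /= tr_scalar_mx map_trmx.
Qed.

(** * The form given by [J2n] and its isotropic subspaces *)

Lemma J2n_tr (C : numClosedFieldType) n : (J2n C n)^T = - J2n C n.
Proof.
by rewrite /J2n tr_block_mx !trmx0 trmx1 linearN /= trmx1 opp_block_mx !oppr0 opprK.
Qed.

Lemma J2n_conj (C : numClosedFieldType) n : map_mx Num.conj (J2n C n) = J2n C n.
Proof.
by rewrite /J2n map_block_mx map_mxN map_mx1 !map_mx0.
Qed.

Lemma J2n_sqr (C : numClosedFieldType) n : J2n C n *m J2n C n = - 1%:M.
Proof.
rewrite /J2n mulmx_block !mulmx0 !mul0mx !mulmx1 mul1mx !addr0 add0r.
by rewrite scalar_mx_block opp_block_mx !oppr0.
Qed.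

Lemma J2n_unit (C : numClosedFieldType) n : J2n C n \in unitmx.
Proof.
have : J2n C n *m - J2n C n = 1%:M by rewrite mulmxN J2n_sqr opprK.
by case/mulmx1_unit.
Qed.

Lemma symplecticE (C : numClosedFieldType) n (S : 'M[C]_(n + n)) :
  symplectic S <-> S ^t* *m J2n C n *m S = J2n C n.
Proof.
split=> [[Su /(congr1 (mulmx (J2n C n)))] | SJS].
  rewrite J2n_tr !mulmxA mulmxN J2n_sqr opprK mul1mx => ->.
  by rewrite mulmxKV.
have e : (J2n C n)^T *m S ^t* *m J2n C n *m S = 1%:M.
  by rewrite -!mulmxA (mulmxA (S ^t*)) SJS J2n_tr mulNmx J2n_sqr opprK.
have [_ Su] := mulmx1_unit e; split=> //.
by rewrite -[LHS](mulmxK Su) e mul1mx.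
Qed.

(* [eigenspace] consists of row vectors, so from here on vectors are rows, A acts
   through A^T, and V J W^H is, up to conjugation, the form x^H J y on the columns
   of V^T and W^T. *)
Lemma skew_hamiltonian_tr (C : numClosedFieldType) n (A : 'M[C]_(n + n)) :
  skew_hamiltonian A -> A^T *m J2n C n = J2n C n *m A^T ^t*.
Proof.
move=> /(congr1 (fun M => M^T *m J2n C n)) <-.
rewrite !trmx_mul !trmxK map_trmx trmxK J2n_tr.
by rewrite !mulNmx -!mulmxA J2n_sqr !mulmxN mulmx1 opprK.
Qed.

(** The form is skew-Hermitian because [J2n] is real and antisymmetric. Facts about the first
    argument thereby carry over to the second. *)
Lemma gram_eq0_sym (C : numClosedFieldType) n m p
    (V : 'M[C]_(m, n + n)) (W : 'M[C]_(p, n + n)) :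
  V *m J2n C n *m W ^t* = 0 -> W *m J2n C n *m V ^t* = 0.
Proof.
move=> /(congr1 (fun M => M ^t*)); rewrite !trmxC_mul trmxCK trmx0 map_mx0.
rewrite J2n_tr map_mxN J2n_conj mulNmx mulmxN mulmxA.
by move/eqP; rewrite oppr_eq0 => /eqP.
Qed.

Lemma gram_eq0_sub (C : numClosedFieldType) n m m' p
    (V : 'M[C]_(m, n + n)) (V' : 'M[C]_(m', n + n)) (W : 'M[C]_(p, n + n)) :
  (V' <= V)%MS -> V *m J2n C n *m W ^t* = 0 -> V' *m J2n C n *m W ^t* = 0.
Proof. by move=> /submxP[D ->]; rewrite -!mulmxA => ->; rewrite mulmx0. Qed.

Lemma gram_eq0_sums (C : numClosedFieldType) n (I : finType) p
    (V_ : I -> 'M[C]_(n + n)) (W : 'M[C]_(p, n + n)) :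
  (forall i, V_ i *m J2n C n *m W ^t* = 0) ->
  (\sum_i V_ i)%MS *m J2n C n *m W ^t* = 0.
Proof.
move=> VW; rewrite -mulmxA; apply/sub_kermxP/sumsmx_subP => i _.
by apply/sub_kermxP; rewrite mulmxA.
Qed.

Lemma isotropic_sums (C : numClosedFieldType) n (I : finType) (V_ : I -> 'M[C]_(n + n)) :
  (forall i j, V_ i *m J2n C n *m (V_ j) ^t* = 0) ->
  (\sum_i V_ i)%MS *m J2n C n *m (\sum_i V_ i)%MS ^t* = 0.
Proof.
by move=> VV; apply: gram_eq0_sums => i; apply/gram_eq0_sym/gram_eq0_sums.
Qed.

(** The row space of [V] lies in the kernel of J V^H, whose dimension is 2n - rank V because J is
    invertible. *)
Lemma isotropic_rank (C : numClosedFieldType) n m (V : 'M[C]_(m, n + n)) :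
  V *m J2n C n *m V ^t* = 0 -> (\rank V <= n)%N.
Proof.
rewrite -mulmxA => /sub_kermxP/mxrankS; rewrite mxrank_ker.
rewrite eqmxMfull ?row_full_unit ?J2n_unit // mxrank_map mxrank_tr.
by have := rank_leq_col V; lia.
Qed.

(** * Eigenspaces of a skew-Hamiltonian matrix *)

(** Moving [A^T] from one argument of the form to the other shows that the Gram matrix is multiplied
    by [a] and by the conjugate of [b] with the same result. *)
Lemma eigenspace_gram (C : numClosedFieldType) n (A : 'M[C]_(n + n)) a b :
  skew_hamiltonian A -> a != b^* ->
  eigenspace A^T a *m J2n C n *m (eigenspace A^T b) ^t* = 0.
Proof.
move=> /skew_hamiltonian_tr AJ ab.
have /eigenspaceP Ea := submx_refl (eigenspace A^T a).
have /eigenspaceP Eb := submx_refl (eigenspace A^T b).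
set U := eigenspace _ a in Ea *; set W := eigenspace _ b in Eb *.
have : a *: U *m J2n C n *m W ^t* = b^* *: (U *m J2n C n *m W ^t*).
  rewrite -Ea -[in LHS](mulmxA U) AJ scalemxAr -map_mxZ -linearZ /=.
  by rewrite -Eb (trmxC_mul W) !mulmxA.
move/eqP; rewrite -!scalemxAl -subr_eq0 -scalerBl scaler_eq0 subr_eq0 (negPf ab) /=.
by move/eqP.
Qed.

(** The last two clauses ensure that, of two conjugate non-real eigenvalues, at most one contributes
    to the sum of the first components, and likewise for the second. *)
Lemma eigenspace_split (C : numClosedFieldType) n (A : 'M[C]_(n + n)) (a : C) :
  skew_hamiltonian A ->
  (a \is Num.real -> eigenvalue A a ->
     exists (m : nat) (V : 'M[C]_(n + n, m)),
       eigenspace_basis A a V /\ balanced (V ^t* *m J2n C n *m V)) ->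
  exists XZ : 'M[C]_(n + n) * 'M[C]_(n + n),
    [/\ [/\ (XZ.1 <= eigenspace A^T a)%MS, (XZ.2 <= eigenspace A^T a)%MS &
            (eigenspace A^T a <= XZ.1 + XZ.2)%MS],
        XZ.1 *m J2n C n *m XZ.1 ^t* = 0, XZ.2 *m J2n C n *m XZ.2 ^t* = 0,
        'Im a < 0 -> XZ.1 = 0 & 0 < 'Im a -> XZ.2 = 0].
Proof.
move=> skA Hreal; have [aR|aNR] := boolP (a \is Num.real); last first.
  (* A non-real [a] differs from its conjugate, so the whole eigenspace is isotropic. *)
  have iE : eigenspace A^T a *m J2n C n *m (eigenspace A^T a) ^t* = 0.
    by apply: eigenspace_gram => //; apply: contraNneq aNR => /esym/CrealP.
  have : 'Im a != 0 by apply: contraNneq aNR => Ia; apply/Creal_ImP.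
  case: (real_ltgtP (real0 C) (Creal_Im a)) => // Ia _.
    exists (eigenspace A^T a, 0); rewrite /= !mul0mx sub0mx submx_refl addsmxSl.
    by split=> // I0; rewrite (lt_gtF Ia) in I0.
  exists (0, eigenspace A^T a); rewrite /= !mul0mx sub0mx submx_refl addsmxSr.
  by split=> // I0; rewrite (lt_gtF Ia) in I0.
have /Creal_ImP Ia := aR; rewrite Ia ltxx.
have [ea|nea] := boolP (eigenvalue A a); last first.
  have E0 : eigenspace A^T a = 0.
    apply/eqP; apply: contraNT nea => E0.
    have : eigenvalue A^T a by [].
    by rewrite !eigenvalue_root_char char_poly_tr.
  by exists (0, 0); rewrite /= E0 !mul0mx !sub0mx; split.
have [m [V [[Vfree VE] balV]]] := Hreal aR ea.
have skK : (V ^t* *m J2n C n *m V) ^t* = - (V ^t* *m J2n C n *m V).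
  by rewrite !trmxC_mul trmxCK J2n_tr map_mxN J2n_conj mulNmx mulmxN mulmxA.
have [X [Z [XX ZZ XZ]]] := balanced_isotropic skK balV.
have VEle : (V^T <= eigenspace A^T a)%MS by rewrite (eqmxP VE).
(* The Gram matrix of the rows of [V^T] is the conjugate of V^H J V, so coefficient rows must be
   conjugated too. The brackets replace the product by a square matrix with the same row space. *)
have iso (Y : 'M[C]_m) : Y *m (V ^t* *m J2n C n *m V) *m Y ^t* = 0 ->
    (<<map_mx Num.conj Y *m V^T>>)%MS *m J2n C n *m (<<map_mx Num.conj Y *m V^T>>)%MS ^t* = 0.
  move=> YY.
  have e : (map_mx Num.conj Y *m V^T) *m J2n C n *m (map_mx Num.conj Y *m V^T) ^t* = 0.
    have := congr1 (fun M => map_mx Num.conj M) YY; rewrite map_mx0 !map_mxM J2n_conj.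
    rewrite trmxC_mul trmxK map_trmx -!map_mx_comp.
    by rewrite !(map_mx_id (@conjCK C)) !mulmxA.
  apply: gram_eq0_sub (_ : _ <= map_mx Num.conj Y *m V^T)%MS _; first by rewrite genmxE.
  apply: gram_eq0_sym; apply: gram_eq0_sub e; by rewrite genmxE.
exists (<<map_mx Num.conj X *m V^T>>%MS, <<map_mx Num.conj Z *m V^T>>%MS) => /=.
split=> //; try exact: iso.
split; rewrite ?genmxE; try exact: mulmx_sub.
rewrite -(eqmxP VE) (adds_eqmx (genmxE _) (genmxE _)) -addsmxMr.
rewrite -{1}[V^T]mul1mx submxMr // -(map_mx1 Num.conj).
by rewrite -map_addsmx map_submx.
Qed.

(** * Symplectic diagonalizability forces balance *)

(** The anticommutation of J with the sign matrix reads t_i J_ij = - J_ij t_j entry by entry, hence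
    it persists after selecting indices by [f]. *)
Lemma balanced_J2n_sub (C : numClosedFieldType) n m (f : 'I_m -> 'I_(n + n)) :
  balanced (mxsub f f (J2n C n)).
Proof.
pose t : 'rV[C]_(n + n) := row_mx (const_mx 1) (const_mx (- 1)).
have tJ : diag_mx t *m J2n C n = - J2n C n *m diag_mx t.
  rewrite diag_mx_row /J2n opp_block_mx !diag_const_mx !oppr0 opprK.
  rewrite !mulmx_block !mulmx0 !mul0mx !addr0 !add0r !mulmx1.
  by rewrite (raddfN (@scalar_mx C n)) /= mulmxN mulmx1 opprK.
have t0 i : t 0 i != 0.
  rewrite mxE; case: split => k; by rewrite mxE ?oppr_eq0 oner_eq0.
apply: (@balanced_opp C m (diag_mx (\row_i t 0 (f i)))).
- by rewrite trmx_mxsub map_mxsub J2n_tr map_mxN J2n_conj; apply/matrixP => i j; rewrite !mxE.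
- by rewrite unitmxE det_diag unitfE; apply/prodf_neq0 => i _; rewrite mxE.
apply/matrixP => i j; have /matrixP/(_ (f i) (f j)) := tJ.
by rewrite !mul_diag_mx !mul_mx_diag !mxE.
Qed.

(** The witness consists of the columns of [S] with diagonal entry [a]; this gives the forward
    direction of both equivalences. *)
Lemma symplectic_diagonalizable_balanced (C : numClosedFieldType) n (A : 'M[C]_(n + n)) a :
  symplectic_diagonalizable A ->
  exists (m : nat) (V : 'M[C]_(n + n, m)),
    eigenspace_basis A a V /\ balanced (V ^t* *m J2n C n *m V).
Proof.
move=> [S [Ssym /diag_mxP[d SAS]]]; have [Su _] := Ssym.
have STA : S^T *m A^T = diag_mx d *m S^T.
  have /(congr1 (fun M => (S *m M)^T)) := SAS.
  by rewrite !mulmxA mulmxV // mul1mx !trmx_mul tr_diag_mx.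
pose P := [pred j | d 0 j == a].
pose f : 'I_#|P| -> 'I_(n + n) := enum_val.
exists #|P|, (colsub f S); split; last first.
  rewrite trmx_mxsub map_mxsub mul_rowsub_mx -mxsub_mul.
  by rewrite (iffLR (symplecticE S) Ssym); apply: balanced_J2n_sub.
have SuT : S^T \in unitmx by rewrite unitmx_tr.
rewrite /eigenspace_basis trmx_mxsub; split.
  apply/row_freeP; exists (colsub f (invmx S^T)).
  rewrite -mxsub_mul mulmxV //; apply/matrixP => i j.
  by rewrite !mxE (inj_eq enum_val_inj).
apply/andP; split.
  apply/eigenspaceP; rewrite mul_rowsub_mx STA mul_diag_mx.
  apply/matrixP => i j; rewrite !mxE; congr (_ * _).
  by apply/eqP; have := enum_valP i.
have /eigenspaceP := submx_refl (eigenspace A^T a).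
move: (eigenspace _ _) => E EA.
(* In coordinates with respect to the rows of [S^T], being an eigenvector for [a] forces the k-th
   coordinate to vanish unless d_k = a. *)
have Wd : (E *m invmx S^T) *m diag_mx d = a *: (E *m invmx S^T).
  rewrite scalemxAl -EA -!mulmxA; congr (_ *m _).
  by rewrite -[diag_mx d](mulmxK SuT) -STA !mulmxA mulVmx // mul1mx.
rewrite -[E](mulmxKV SuT); move: (E *m _) Wd => W.
rewrite mul_mx_diag => /matrixP Wd.
suff -> : W *m S^T = colsub f W *m rowsub f S^T by rewrite submxMl.
apply/matrixP => i j; rewrite !mxE.
under [RHS]eq_bigr => k _ do rewrite !mxE.
rewrite -(big_enum_val (fun k => W i k * S j k)) /=.
rewrite (bigID P) /= [X in _ + X]big1 ?addr0 => [|k dk].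
  by apply: eq_bigr => k _; rewrite mxE.
have := Wd i k; rewrite !mxE mulrC => /eqP; rewrite -subr_eq0 -mulrBl mulf_eq0.
by rewrite subr_eq0 (negPf dk) => /eqP ->; rewrite mul0r.
Qed.

(** * From isotropic pieces of eigenspaces to a symplectic eigenbasis *)

(** Stacking all [V_ i] gives a spanning family of eigenvectors. Selecting a maximal free set of its
    rows keeps them eigenvectors, whereas a basis from elimination could mix eigenvalues. *)
Lemma eigenrow_basis (F : fieldType) N (B : 'M[F]_N) (I : finType) (V_ : I -> 'M[F]_N)
    (a_ : I -> F) :
  (forall i, (V_ i <= eigenspace B (a_ i))%MS) ->
  exists X : 'M_(\rank (\sum_i V_ i), N), exists d : 'rV[F]_(\rank (\sum_i V_ i)),
    [/\ row_free X, (X :=: \sum_i V_ i)%MS & X *m B = diag_mx d *m X].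
Proof.
move=> VE.
suff [m [M [d0 [eM MB]]]] : exists m, exists M : 'M_(m, N), exists d : 'rV[F]_m,
    (M :=: \sum_i V_ i)%MS /\ M *m B = diag_mx d *m M.
  rewrite -eM; exists (rowsub (maxrankfun M) M), (colsub (maxrankfun M) d0).
  split; first exact: maxrowsub_free.
    exact: eqmx_trans (eq_maxrowsub M) eM.
  rewrite mul_rowsub_mx MB !mul_diag_mx; apply/matrixP => i j; by rewrite !mxE.
elim: (index_enum I) => [|i r [m [M [d [eM MB]]]]].
  by exists 0%N, 0, 0; rewrite big_nil mul0mx mulmx0; split => //; apply/eqmxP; rewrite !sub0mx.
exists (N + m)%N, (col_mx (V_ i) M), (row_mx (const_mx (a_ i)) d); split.
  rewrite big_cons; apply: eqmx_trans (eqmx_sym (addsmxE _ _)) _.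
  exact: adds_eqmx.
rewrite mul_col_mx (eigenspaceP (VE i)) MB diag_mx_row mul_block_col !mul0mx addr0 add0r.
by rewrite diag_const_mx mul_scalar_mx.
Qed.

Lemma lagrangian_symplectic_diagonalizable (C : numClosedFieldType) n
    (A : 'M[C]_(n + n)) (X Z : 'M[C]_(n, n + n)) (d : 'rV[C]_n) :
  skew_hamiltonian A ->
  X *m J2n C n *m X ^t* = 0 -> Z *m J2n C n *m Z ^t* = 0 ->
  row_free (col_mx X Z) -> X *m A^T = diag_mx d *m X -> stablemx Z A^T ->
  symplectic_diagonalizable A.
Proof.
move=> /skew_hamiltonian_tr AJ XX ZZ XZ XA /submxP[B ZA].
pose G := X *m J2n C n *m Z ^t*.
(* If w G = 0, then w X is orthogonal to [Z], and to [X] by isotropy, hence to the whole space;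
   nondegeneracy of J gives w = 0. *)
have Gu : G \in unitmx.
  rewrite -row_free_unit -kermx_eq0; apply/rowV0P => w /sub_kermxP wG.
  have : row_mx w 0 *m col_mx X Z *m J2n C n *m (col_mx X Z) ^t* = 0.
    rewrite mul_row_col mul0mx addr0 tr_col_mx map_row_mx mul_mx_row -!mulmxA.
    by rewrite (mulmxA X) XX (mulmxA X) -/G wG mulmx0 row_mx0.
  have XZu : col_mx X Z \in unitmx by rewrite -row_free_unit.
  have Ju := J2n_unit C n.
  have XZu' : (col_mx X Z) ^t* \in unitmx by rewrite map_unitmx unitmx_tr.
  move=> /(congr1 (mulmx^~ (invmx ((col_mx X Z) ^t*)))); rewrite mulmxK // mul0mx.
  move=> /(congr1 (mulmx^~ (invmx (J2n C n)))); rewrite mulmxK // mul0mx.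
  move=> /(congr1 (mulmx^~ (invmx (col_mx X Z)))); rewrite mulmxK // mul0mx.
  by rewrite -row_mx0 => /eq_row_mx[].
pose Y := (invmx G) ^t* *m Z.
have XY : X *m J2n C n *m Y ^t* = 1%:M.
  by rewrite trmxC_mul trmxCK mulmxA mulmxV.
have YX : Y *m J2n C n *m X ^t* = - 1%:M.
  have /(congr1 (fun M => M ^t*)) := XY; rewrite !trmxC_mul trmx1 map_mx1.
  by rewrite J2n_tr map_mxN J2n_conj mulNmx mulmxN !trmxCK mulmxA => <-; rewrite opprK.
have YY : Y *m J2n C n *m Y ^t* = 0.
  by rewrite trmxC_mul mulmxA /Y -!(mulmxA _ Z) -(mulmxA _ _ (Z ^t*)) ZZ mulmx0 mul0mx.
(* As [A] is self-adjoint for the form, the vector dual to an eigenvector for d_i has the conjugate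
   eigenvalue. *)
pose e : 'rV[C]_n := map_mx Num.conj d.
have YA : Y *m A^T = diag_mx e *m Y.
  have GB : diag_mx d *m G = G *m B ^t*.
    rewrite /G !mulmxA -XA -(mulmxA X) AJ -!mulmxA -!trmxC_mul.
    by rewrite ZA.
  have eG : diag_mx e *m (invmx G) ^t* = (invmx G) ^t* *m B.
    have /(congr1 (fun M => (invmx G *m M *m invmx G) ^t*)) := GB.
    rewrite (mulmxA _ G) mulVmx // mul1mx mulmxA mulmxK // !trmxC_mul trmxCK.
    by rewrite tr_diag_mx map_diag_mx.
  by rewrite /Y -mulmxA ZA !mulmxA eG.
exists (col_mx X Y)^T.
have TJT : col_mx X Y *m J2n C n *m (col_mx X Y) ^t* = J2n C n.
  rewrite tr_col_mx map_row_mx !mul_col_mx !mul_mx_row XX XY YX YY.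
  by rewrite /J2n.
have Ssym : symplectic (col_mx X Y)^T.
  (* For S = T^T, the matrix S^H J S is the conjugate of T J T^H, and J is real. *)
  apply/symplecticE; have := congr1 (fun M => map_mx Num.conj M) TJT.
  rewrite !map_mxM J2n_conj -!map_trmx trmxK; move=> H.
  by rewrite -[RHS]H -map_mx_comp (map_mx_id (@conjCK C)).
split=> //; have [Su _] := Ssym.
apply/diag_mxP; exists (row_mx d e).
have TA : col_mx X Y *m A^T = diag_mx (row_mx d e) *m col_mx X Y.
  by rewrite mul_col_mx XA YA diag_mx_row mul_block_col !mul0mx addr0 add0r.
have := congr1 trmx TA; rewrite !trmx_mul trmxK tr_diag_mx -mulmxA => ->.
by rewrite mulmxA mulVmx // mul1mx.
Qed.

Lemma diagonalizable_tr (F : fieldType) n (A : 'M[F]_n) :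
  diagonalizable A -> diagonalizable A^T.
Proof.
move=> [P Pu /similar_diagPex[d /(similarP Pu) PA]].
have PTu : P^T \in unitmx by rewrite unitmx_tr.
exists (invmx P^T); first by rewrite unitmx_inv.
apply/similar_diagPex; exists d; apply/similarP; first by rewrite unitmx_inv.
have /(congr1 (fun M => invmx P^T *m M^T *m invmx P^T)) := PA.
by rewrite !trmx_mul tr_diag_mx -!mulmxA mulmxV // mulmx1 !mulmxA mulVmx // mul1mx.
Qed.

Lemma diagonalizable_scale (F : fieldType) n (A : 'M[F]_n) c :
  diagonalizable A -> diagonalizable (c *: A).
Proof.
move=> [P Pu /similar_diagPex[d /(similarP Pu) PA]].
exists P => //; apply/similar_diagPex; exists (c *: d); apply/similarP => //.
by rewrite -scalemxAr PA linearZ /= scalemxAl.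
Qed.

(** Two different summands are orthogonal by [eigenspace_gram] unless their eigenvalues are
    conjugate, and then one of them is zero. *)
Lemma isotropic_eigen_sums (C : numClosedFieldType) n (A : 'M[C]_(n + n)) (I : finType)
    (a_ : I -> C) (V_ : I -> 'M[C]_(n + n)) :
  skew_hamiltonian A -> (forall i, V_ i <= eigenspace A^T (a_ i))%MS ->
  (forall i, V_ i *m J2n C n *m (V_ i) ^t* = 0) ->
  (forall i j, i != j -> a_ i = (a_ j)^* -> V_ i = 0 \/ V_ j = 0) ->
  (\sum_i V_ i)%MS *m J2n C n *m (\sum_i V_ i)%MS ^t* = 0.
Proof.
move=> skA VE VV V0; apply: isotropic_sums => i j.
have [<- // | nij] := eqVneq i j.
have [aij | aij] := eqVneq (a_ i) (a_ j)^*.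
  by have [-> | ->] := V0 i j nij aij; rewrite ?trmx0 ?map_mx0 ?mul0mx ?mulmx0.
apply: gram_eq0_sub (VE i) _; apply/gram_eq0_sym/(gram_eq0_sub (VE j))/gram_eq0_sym.
exact: eigenspace_gram.
Qed.

Lemma skew_symplectic_diagonalizableP (C : numClosedFieldType) n (A : 'M[C]_(n + n)) :
  diagonalizable A -> skew_hamiltonian A ->
  symplectic_diagonalizable A <->
  forall a : C, a \is Num.real -> eigenvalue A a ->
    exists (m : nat) (V : 'M[C]_(n + n, m)),
      eigenspace_basis A a V /\ balanced (V ^t* *m J2n C n *m V).
Proof.
move=> /diagonalizable_tr/diagonalizablePeigen[rs rs_uniq].
rewrite (big_nth 0) big_mkord => eE skA.
split=> [SD a _ _ | Hreal]; first exact: symplectic_diagonalizable_balanced.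
have /fin_all_exists[XZ XZP] (i : 'I_(size rs)) :=
  eigenspace_split skA (Hreal rs`_i).
(* Conjugate entries at different positions cannot be real, since [rs] has no repetitions; so their
   imaginary parts have opposite signs. *)
have Im_neq0 (i j : 'I_(size rs)) : i != j -> rs`_i = (rs`_j)^* ->
    ('Im rs`_i < 0 /\ 0 < 'Im rs`_j) \/ (0 < 'Im rs`_i /\ 'Im rs`_j < 0).
  move=> nij eij; have Iij : 'Im rs`_i = - 'Im rs`_j by rewrite eij Im_conj.
  rewrite Iij oppr_lt0 oppr_gt0.
  case: (real_ltgtP (real0 C) (Creal_Im rs`_j)) => Ij; [by left | by right |].
  case/eqP: nij; apply/val_inj/eqP; rewrite -(nth_uniq 0 (ltn_ord i) (ltn_ord j) rs_uniq).
  by apply/eqP; rewrite [LHS]eij; apply/CrealP/Creal_ImP.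
pose L := (\sum_i (XZ i).1)%MS; pose M := (\sum_i (XZ i).2)%MS.
have LL : L *m J2n C n *m L ^t* = 0.
  apply: (isotropic_eigen_sums skA (a_ := fun i : 'I_(size rs) => rs`_i)).
  - by move=> i; have [[]] := XZP i.
  - by move=> i; have [] := XZP i.
  move=> i j nij /(Im_neq0 _ _ nij)[[Ii _] | [_ Ij]].
    by left; have [_ _ _ ->] := XZP i.
  by right; have [_ _ _ ->] := XZP j.
have MM : M *m J2n C n *m M ^t* = 0.
  apply: (isotropic_eigen_sums skA (a_ := fun i : 'I_(size rs) => rs`_i)).
  - by move=> i; have [[]] := XZP i.
  - by move=> i; have [] := XZP i.
  move=> i j nij /(Im_neq0 _ _ nij)[[_ Ij] | [Ii _]].
    by right; have [_ _ _ _ ->] := XZP j.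
  by left; have [_ _ _ _ ->] := XZP i.
have LM : (1%:M <= L + M)%MS.
  rewrite -eE; apply/sumsmx_subP => i _; have [[_ _ EXZ] _ _ _ _] := XZP i.
  apply: submx_trans EXZ _; apply: addsmxS.
    exact: (sumsmx_sup i).
  exact: (sumsmx_sup i).
have rLM : (n + n <= \rank L + \rank M)%N.
  rewrite -{1}(mxrank1 C (n + n)); apply: leq_trans (mxrankS LM) _.
  exact: mxrank_adds_leqif.
(* Both ranks are at most n and add up to at least 2n. *)
have rL : \rank L = n by have := isotropic_rank LL; have := isotropic_rank MM; lia.
have rM : \rank M = n by have := isotropic_rank LL; have := isotropic_rank MM; lia.
have Mst : stablemx M A^T.
  rewrite /M sumsmxMr; apply/sumsmx_subP => i _; have [[_ ZE _] _ _ _ _] := XZP i.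
  by rewrite (eigenspaceP ZE) scalemx_sub // (sumsmx_sup i).
have := @eigenrow_basis C _ A^T _ (fun i => (XZ i).1) (fun i : 'I_(size rs) => rs`_i).
rewrite -/L rL => -[|X [d [Xfree XL XA]]]; first by move=> i; have [[]] := XZP i.
(* Any basis of [M] will do here: stability under [A^T] is enough for its dual basis to consist of
   eigenvectors. *)
pose Z := castmx (rM, erefl) (row_base M).
have ZM : (Z :=: M)%MS by apply: eqmx_trans (eqmx_cast _ _) (eq_row_base M).
have iso (W : 'M[C]_(n, n + n)) (U : 'M[C]_(n + n)) : (W :=: U)%MS ->
    U *m J2n C n *m U ^t* = 0 -> W *m J2n C n *m W ^t* = 0.
  move=> WU UU; have WUle : (W <= U)%MS by rewrite WU.
  by apply: (gram_eq0_sub WUle); apply/gram_eq0_sym/(gram_eq0_sub WUle).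
apply: (@lagrangian_symplectic_diagonalizable C n A X Z d) => //.
- exact: iso XL LL.
- exact: iso ZM MM.
- rewrite -row_leq_rank -addsmxE (adds_eqmx XL ZM) -{1}(mxrank1 C (n + n)).
  exact: mxrankS.
by rewrite (eqmxMr A^T ZM) ZM.
Qed.

(** * The Hamiltonian case, by scaling with ['i] *)

Lemma symplectic_diagonalizable_scale (C : numClosedFieldType) n (A : 'M[C]_(n + n)) c :
  symplectic_diagonalizable A -> symplectic_diagonalizable (c *: A).
Proof.
move=> [S [Ss /diag_mxP[d SAS]]]; exists S; split=> //; apply/diag_mxP.
by exists (c *: d); rewrite -scalemxAr -scalemxAl SAS linearZ.
Qed.

Lemma eigenspace_scale (F : fieldType) n (A : 'M[F]_n) c a : c != 0 ->
  (eigenspace (c *: A) (c * a) :=: eigenspace A a)%MS.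
Proof.
move=> c0; apply/eqmxP/andP; split; apply/eigenspaceP.
  apply: (scalerI c0); rewrite scalerA scalemxAr.
  by apply/eigenspaceP; rewrite submx_refl.
by rewrite -scalemxAr -scalerA; congr (_ *: _); apply/eigenspaceP; rewrite submx_refl.
Qed.

Lemma eigenvalue_scale (F : fieldType) n (A : 'M[F]_n) c a : c != 0 ->
  eigenvalue (c *: A) (c * a) = eigenvalue A a.
Proof. by move=> c0; rewrite /eigenvalue -!mxrank_eq0 eigenspace_scale. Qed.

Lemma eigenspace_basis_scale (C : numClosedFieldType) p m (A : 'M[C]_p) c a
    (V : 'M[C]_(p, m)) :
  c != 0 -> eigenspace_basis (c *: A) (c * a) V <-> eigenspace_basis A a V.
Proof. by move=> c0; rewrite /eigenspace_basis [(c *: A)^T]linearZ /= !(eigenspace_scale A^T a c0). Qed.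

Lemma skew_hamiltonian_Ci (C : numClosedFieldType) n (A : 'M[C]_(n + n)) :
  hamiltonian A -> skew_hamiltonian ('i *: A).
Proof.
rewrite /skew_hamiltonian linearZ /= map_mxZ -scalemxAr -scalemxAl => ->.
by rewrite /= conjCi scaleNr scalerN opprK.
Qed.

Lemma hamiltonian_symplectic_diagonalizableP (C : numClosedFieldType) n (A : 'M[C]_(n + n)) :
  diagonalizable A -> hamiltonian A ->
  symplectic_diagonalizable A <->
  forall a : C, 'Re a = 0 -> eigenvalue A a ->
    exists (m : nat) (V : 'M[C]_(n + n, m)),
      eigenspace_basis A a V /\ balanced (V ^t* *m J2n C n *m V).
Proof.
move=> dA hA; have i0 := neq0Ci C.
split=> [SD a _ _ | Himag]; first exact: symplectic_diagonalizable_balanced.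
have -> : A = - 'i *: ('i *: A) by rewrite scalerA mulNr -expr2 sqrCi opprK scale1r.
apply: symplectic_diagonalizable_scale.
apply/skew_symplectic_diagonalizableP.
- exact: diagonalizable_scale.
- exact: skew_hamiltonian_Ci.
(* A real eigenvalue [b] of ['i *: A] comes from the purely imaginary eigenvalue [- 'i * b] of [A],
   with the same eigenspace, so the same [V] serves. *)
move=> b bR; have -> : b = 'i * (- 'i * b).
  by rewrite mulrA mulrN -expr2 sqrCi opprK mul1r.
rewrite eigenvalue_scale // => /Himag[|m [V [Vb balV]]].
  by rewrite mulNr raddfN /= ReMil (Creal_ImP _ bR) opprK.
by exists m, V; split=> //; apply/eigenspace_basis_scale.
Qed.

Theorem theorem1 (R : realType) (n : nat) (A : 'M[R[i]]_(n + n))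
    (diagA : diagonalizable A) :
  (skew_hamiltonian A ->
     (symplectic_diagonalizable A <->
      forall a : R[i], a \is Num.real -> eigenvalue A a ->
        exists (m : nat) (V : 'M[R[i]]_(n + n, m)),
          eigenspace_basis A a V /\ balanced (V ^t* *m J2n R[i] n *m V)))
  /\
  (hamiltonian A ->
     (symplectic_diagonalizable A <->
      forall a : R[i], 'Re a = 0 -> eigenvalue A a ->
        exists (m : nat) (V : 'M[R[i]]_(n + n, m)),
          eigenspace_basis A a V /\ balanced (V ^t* *m J2n R[i] n *m V))).
Proof.
split=> [skA | hA]; first exact: skew_symplectic_diagonalizableP.
exact: hamiltonian_symplectic_diagonalizableP.
Qed.
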